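(* Let $R$ be a ring, let $\mathcal{M}$ be one of the following three classes of homomorphisms of left $R$-modules: all embeddings, all $RD$-embeddings, all pure embeddings, and let $K$ be a class of left $R$-modules closed under direct sums, $\mathcal{M}$-submodules and $\mathcal{M}$-epimorphic images. Let $E \in K$. Then $E$ is $\mathcal{K}_\mathcal{M}$-injective if and only if for every $\mathcal{M}$-embedding $f: A \to B$ with $A, B \in K$ and $\|A\|, \|B\| \leq \operatorname{card}(R) + \aleph_0$, and every $R$-homomorphism $g: A \to E$, there is an $R$-homomorphism $h: B \to E$ such that $h \circ f = g$.
   Context: Rings are associative with unity; modules are left $R$-modules; $\|A\|$ is the cardinality of $A$ and $\operatorname{card}(R)$ that of $R$. Pure embeddings and pure epimorphisms are meant in the usual sense. A short exact sequence $0 \to A \xrightarrow{f} B \xrightarrow{g} C \to 0$ is $RD$-exact if $f[A] \cap rB = r f[A]$ for every $r \in R$; then $f$ is an $RD$-embedding and $g$ an $RD$-epimorphism. An $\mathcal{M}$-embedding is a member of $\mathcal{M}$; an $\mathcal{M}$-epimorphism is the map $g$ in a short exact sequence $0 \to A \xrightarrow{f} B \xrightarrow{g} C \to 0$ with $f \in \mathcal{M}$ (so for $\mathcal{M}$ the class of all embeddings, any surjective homomorphism). $A \leq_\mathcal{M} B$ means that $A$ is a submodule of $B$ and the inclusion is in $\mathcal{M}$. ''$K$ is closed under $\mathcal{M}$-submodules'' means $A \in K$ and $B \leq_\mathcal{M} A$ imply $B \in K$; ''closed under $\mathcal{M}$-epimorphic images'' means that if $f : A \to B$ is an $\mathcal{M}$-epimorphism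 and $A \in K$ then $B \in K$. A module $E \in K$ is $\mathcal{K}_\mathcal{M}$-injective if for every $\mathcal{M}$-embedding $f: A \to B$ with $A, B \in K$ (no cardinality restriction) and every $R$-homomorphism $g: A \to E$ there is an $R$-homomorphism $h: B \to E$ with $h \circ f = g$. *)

(* Defs.v *)
From HB Require Import structures.
From mathcomp Require Import all_boot all_algebra.
From mathcomp Require Import boolp classical_sets functions cardinality.

Set Implicit Arguments.
Unset Strict Implicit.
Unset Printing Implicit Defensive.

Import GRing.Theory.
Local Open Scope classical_set_scope.
Local Open Scope ring_scope.

(* Rings are [pzRingType]s: associative with unity, the zero ring included.
   Left modules are [lmodType]s; the choice structure they carry is no
   restriction, as [boolp] provides one on every type. *)

(* Dependent functions are wrapped in an alias so that the module structure
   can be declared for them. *)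
Definition direct_product (R : pzRingType) (I : Type) (M : I -> lmodType R) :=
  forall i, M i.

Section DirectSum.
Variables (R : pzRingType) (I : Type) (M : I -> lmodType R).
Local Notation P := (direct_product M).

HB.instance Definition _ := gen_eqMixin P.
HB.instance Definition _ := gen_choiceMixin P.

Let add (f g : P) : P := fun i => f i + g i.
Let zero : P := fun i => 0.
Let opp (f : P) : P := fun i => - f i.
Let scale (r : R) (f : P) : P := fun i => r *: f i.

Let addA : associative add.
Proof. by move=> f g h; apply: functional_extensionality_dep => i; exact: addrA. Qed.
Let addC : commutative add.
Proof. by move=> f g; apply: functional_extensionality_dep => i; exact: addrC. Qed.
Let add0 : left_id zero add.
Proof. by move=> f; apply: functional_extensionality_dep => i; exact: add0r. Qed.
Let addN : left_inverse zero opp add.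
Proof. by move=> f; apply: functional_extensionality_dep => i; exact: addNr. Qed.

HB.instance Definition _ := GRing.isZmodule.Build P addA addC add0 addN.

Let scaleA a b (f : P) : scale a (scale b f) = scale (a * b) f.
Proof. by apply: functional_extensionality_dep => i; exact: scalerA. Qed.
Let scale1 : left_id 1 scale.
Proof. by move=> f; apply: functional_extensionality_dep => i; exact: scale1r. Qed.
Let scaleDr : right_distributive scale +%R.
Proof. by move=> a f g; apply: functional_extensionality_dep => i; exact: scalerDr. Qed.
Let scaleDl (f : P) : {morph scale^~ f : a b / a + b}.
Proof. by move=> a b; apply: functional_extensionality_dep => i; exact: scalerDl. Qed.

HB.instance Definition _ :=
  GRing.Zmodule_isLmodule.Build R P scaleA scale1 scaleDr scaleDl.

Definition finite_support : pred P :=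
  fun f => `[< finite_set [set i | f i <> 0] >].

Lemma finite_support_submod : subsemimod_closed finite_support.
Proof.
split; first split.
- by apply/asboolP; rewrite (_ : [set _ | _] = set0) // -subset0 => i /=.
- move=> f g /asboolP finf /asboolP fing; apply/asboolP.
  apply: (@sub_finite_set _ _ ([set i | f i <> 0] `|` [set i | g i <> 0])).
    move=> i /= fgi; have [fi|] := pselect (f i = 0); last by left.
    by right => gi; apply: fgi; rewrite -[LHS]/(f i + g i) fi gi addr0.
  by rewrite finite_setU.
- move=> r f /asboolP finf; apply/asboolP; apply: sub_finite_set finf.
  by move=> i /= rfi fi; apply: rfi; rewrite -[LHS]/(r *: f i) fi scaler0.
Qed.

Record direct_sum := DirectSum {
  direct_sum_val : P;
  direct_sum_finite : finite_support direct_sum_val }.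

HB.instance Definition _ := [isSub for direct_sum_val].
HB.instance Definition _ := [Choice of direct_sum by <:].
HB.instance Definition _ :=
  GRing.SubChoice_isSubLmodule.Build R P finite_support direct_sum
    finite_support_submod.

End DirectSum.

Section Classes.
Variable R : pzRingType.

Definition hom_class := forall A B : lmodType R, {linear A -> B} -> Prop.

Definition all_embeddings : hom_class := fun A B f => injective f.

Definition RD_embeddings : hom_class := fun A B f =>
  injective f /\
  forall r : R,
    range f `&` [set r *: b | b in [set: B]] = [set r *: b | b in range f].

(* Every finite system of linear equations with constants in f[A] that is
   solvable in B is solvable in f[A]; solutions and constants are pulled back
   to A along the injection f. *)
Definition pure_embeddings : hom_class := fun A B f =>
  injective f /\
  forall (m n : nat) (S : 'M[R]_(m, n)) (a : 'I_m -> A),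
    (exists b : 'I_n -> B, forall i, \sum_(j < n) S i j *: b j = f (a i)) ->
    exists x : 'I_n -> A, forall i, \sum_(j < n) S i j *: x j = a i.

Definition short_exact (A B C : lmodType R)
    (f : {linear A -> B}) (g : {linear B -> C}) : Prop :=
  [/\ injective f, range f = [set b | g b = 0] & range g = [set: C]].

Definition epimorphism_of (M : hom_class) (B C : lmodType R)
    (g : {linear B -> C}) : Prop :=
  exists (A : lmodType R) (f : {linear A -> B}), short_exact f g /\ M A B f.

Definition closed_direct_sums (K : lmodType R -> Prop) : Prop :=
  forall (I : Type) (F : I -> lmodType R),
    (forall i, K (F i)) -> K (direct_sum F).

Definition closed_submodules (M : hom_class) (K : lmodType R -> Prop) : Prop :=
  forall (A : lmodType R) (S : pred A) (B : subLmodType S),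
    K A -> M B A (val : {linear B -> A}) -> K B.

Definition closed_epimorphic_images (M : hom_class)
    (K : lmodType R -> Prop) : Prop :=
  forall (A B : lmodType R) (f : {linear A -> B}),
    epimorphism_of M f -> K A -> K B.

Definition relatively_injective (K : lmodType R -> Prop) (M : hom_class)
    (E : lmodType R) : Prop :=
  K E /\
  forall (A B : lmodType R) (f : {linear A -> B}) (g : {linear A -> E}),
    K A -> K B -> M A B f ->
    exists h : {linear B -> E}, h \o f =1 g.

(* The disjoint sum R + nat has cardinality card(R) + aleph_0. *)
Definition card_le_ring (A : lmodType R) : Prop :=
  ([set: A] #<= [set: (R + nat)%type])%card.

End Classes.

(* Main.v *)
Require Import Defs.
From mathcomp Require Import all_boot all_algebra.
From HB Require Import structures.
From mathcomp Require Import boolp classical_sets functions cardinality.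

(** This is Baer's argument, with the extension by a cyclic module replaced by
    an extension by a module of cardinality at most card(R) + aleph_0.

    Each of the three classes consists of the embeddings that reflect the
    solvability of the linear systems in some set Sigma: no system, the
    systems r x = a, or all systems ([embedding_class_pure]). Call these
    embeddings, and the corresponding submodules, pure.

    Let f : A -> B be a pure embedding and g : A -> E. Consider the partial
    maps from B to E with a pure domain that extend g along f, starting with
    the one defined on the range of f. A finite system with constants in the
    union of a chain of domains has its constants in one of them, so such
    unions are again pure, and Zorn's lemma yields a maximal partial map, with
    domain A' say ([Zorn_above], [pure_graph_chain]).

    Suppose b is in B. A Loewenheim-Skolem argument gives a submodule H of B
    that contains b, has cardinality at most card(R) + aleph_0, and is such
    that H, A' `&` H and A' + H are all pure in B ([small_submodule]). As K is
    closed under pure submodules, H and A' `&` H belong to K, and the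
    hypothesis on small embeddings extends the partial map from A' `&` H to H.
    The two maps glue to A' + H ([pure_graph_extend]). By maximality b lies in
    A', so A' = B.

    The cardinality of H rests on the injection of T * T into T for
    T = R + nat ([pairing_exists]), which makes finite trees labelled by the
    requests for solutions no more numerous than T ([small_closed_set]). *)

Set Implicit Arguments.
Unset Strict Implicit.
Unset Printing Implicit Defensive.

Import GRing.Theory.
Local Open Scope classical_set_scope.

(** * Zorn's lemma and unions of chains *)

(** Zorn's lemma for families of sets wants every chain bounded, the empty
    one included. Running it on the sets X with [P (G0 `|` X)] lets [G0] bound
    the empty chain, so only unions of nonempty chains have to be examined,
    and the maximal set lies above [G0]. *)
Lemma Zorn_above (T : Type) (P : set (set T)) (G0 : set T) :
    P G0 ->
    (forall F, F `<=` P -> F !=set0 -> total_on F subset ->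
       P (\bigcup_(X in F) X)) ->
  exists G, [/\ P G, G0 `<=` G & forall G', P G' -> G `<=` G' -> G' `<=` G].
Proof.
move=> PG0 Pchain; pose P' : set (set T) := [set X | P (G0 `|` X)].
have [F FP Ftot|A [PA Amax]] := @Zorn_bigcup T P'.
  pose F' := [set Y | Y = G0 \/ exists2 X, F X & Y = G0 `|` X].
  rewrite /P' /=; suff -> : G0 `|` \bigcup_(X in F) X = \bigcup_(Y in F') Y.
    apply: Pchain; first by move=> _ [->|[X /FP PX ->]].
      by exists G0; left.
    move=> _ _ [->|[X FX ->]] [->|[Y FY ->]].
    - by left.
    - by left; exact: subsetUl.
    - by right; exact: subsetUl.
    - by have [XY|YX] := Ftot _ _ FX FY; [left|right]; exact: setUS.
  apply/seteqP; split=> x.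
    move=> [G0x|[X FX Xx]]; first by exists G0; [left|].
    by exists (G0 `|` X); [right; exists X|right].
  move=> [_ [->|[X FX ->]]]; first by left.
  by move=> [G0x|Xx]; [left|right; exists X].
exists (G0 `|` A); split=> // G' PG' sub x G'x.
right; apply: contrapT => nAx; apply: (Amax G').
  by split=> [y Ay|/(_ x G'x)//]; apply: sub; right.
by rewrite /P' /= setUidr // => y G0y; apply: sub; left.
Qed.

Lemma chain_directed (T : Type) (F : set (set T)) (X Y : set T) :
    total_on F subset -> F X -> F Y ->
  exists2 Z, F Z & X `<=` Z /\ Y `<=` Z.
Proof.
move=> Ftot FX FY; have [XY|YX] := Ftot _ _ FX FY.
  by exists Y => //; split=> // x.
by exists X => //; split=> // x.
Qed.

(** Finitary conditions on the union of a chain, such as the solvability of a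
    finite linear system, can thus be tested in one member of the chain. *)
Lemma chain_finite (T : Type) (F : set (set T)) (n : nat) (t : 'I_n -> T) :
    F !=set0 -> total_on F subset -> (forall i, (\bigcup_(X in F) X) (t i)) ->
  exists2 X, F X & forall i, X (t i).
Proof.
move=> F0 Ftot; elim: n t => [|n IHn] t Ft.
  by have [X FX] := F0; exists X => // i; have := ltn_ord i.
have [X FX Xt] := IHn (fun i => t (lift ord0 i)) (fun i => Ft _).
have [Y FY Yt] := Ft ord0.
have [Z FZ [XZ YZ]] := chain_directed Ftot FX FY.
by exists Z => // i; case: (unliftP ord0 i) => [j|] ->; [exact/XZ/Xt|exact: YZ].
Qed.

(** * Infinite sets absorb finite tuples *)

(** Take a maximal partial bijection between [A] and [B]. If it missed a
    point on both sides it could be enlarged by pairing these two points, so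
    it is total on [A] or onto [B]. *)
Lemma card_comparable (T : Type) (A B : set T) :
    (exists f : T -> T, set_fun A B f /\ set_inj A f) \/
    (exists f : T -> T, set_fun B A f /\ set_inj B f).
Proof.
pose P : set (set (T * T)) := [set H |
  (forall x y, H (x, y) -> A x /\ B y) /\
  (forall x y x' y', H (x, y) -> H (x', y') -> x = x' <-> y = y')].
have [F FP Ftot|H [[HAB Hinj] Hmax]] := @Zorn_bigcup _ P.
  split=> [x y [X FX Xxy]|x y x' y' [X FX Xxy] [Y FY Yxy]].
    by apply: (FP _ FX).1.
  have [XY|YX] := Ftot _ _ FX FY.
    by apply: (FP _ FY).2 => //; apply: XY.
  by apply: (FP _ FX).2 => //; apply: YX.
have [domA|/existsNP[a /not_implyP[Aa nHa]]] :=
    pselect (forall x, A x -> exists y, H (x, y)).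
  have [x|f fP] := @choice T T (fun x y => A x -> H (x, y)).
    by have [/domA[y Hy]|nAx] := pselect (A x); [exists y|exists x].
  left; exists f; split=> [x /fP/HAB[]//|x y /set_mem Ax /set_mem Ay].
  by apply: (Hinj _ _ _ _ (fP _ Ax) (fP _ Ay)).2.
have [domB|/existsNP[b /not_implyP[Bb nHb]]] :=
    pselect (forall y, B y -> exists x, H (x, y)).
  have [y|f fP] := @choice T T (fun y x => B y -> H (x, y)).
    by have [/domB[x Hx]|nBy] := pselect (B y); [exists x|exists y].
  right; exists f; split=> [y /fP/HAB[]//|x y /set_mem Bx /set_mem By].
  by apply: (Hinj _ _ _ _ (fP _ Bx) (fP _ By)).1.
exfalso; apply: (Hmax (H `|` [set (a, b)])).
  split=> [?|sub]; first by left.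
  by apply: nHa; exists b; apply: sub; right.
split=> [x y [/HAB//|[-> ->]//]|x y x' y' [Hxy|[-> ->]] [Hxy'|[-> ->]]] //.
- exact: Hinj.
- by split=> e; exfalso; [apply: nHa; exists y|apply: nHb; exists x]; rewrite -e.
- by split=> e; exfalso; [apply: nHa; exists y'|apply: nHb; exists x']; rewrite e.
Qed.

Section Pairing.
Variables (T : Type) (nu : nat -> T).
Hypothesis nu_inj : injective nu.

(** [pairing_graph G] says that [G] is the graph of an injection X * X -> X,
    where X = [field G] is recovered from the diagonal. *)
Let field (G : set (T * T * T)) := [set x | exists z, G (x, x, z)].

Let pairing_graph (G : set (T * T * T)) :=
  [/\ forall x y z z', G (x, y, z) -> G (x, y, z') -> z = z',
      forall q q' z, G (q, z) -> G (q', z) -> q = q',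
      forall x y, field G x -> field G y -> exists z, G (x, y, z)
    & forall x y z, G (x, y, z) -> [/\ field G x, field G y & field G z]].

Let pairing_graph_chain (F : set (set (T * T * T))) :
    F `<=` pairing_graph -> total_on F subset ->
  pairing_graph (\bigcup_(G in F) G).
Proof.
move=> FP Ftot.
split.
- move=> x y z z' [X FX Xz] [Y FY Yz].
  have [Z FZ [XZ YZ]] := chain_directed Ftot FX FY; have [Zf _ _ _] := FP _ FZ.
  exact: Zf (XZ _ Xz) (YZ _ Yz).
- move=> q q' z [X FX Xz] [Y FY Yz].
  have [Z FZ [XZ YZ]] := chain_directed Ftot FX FY; have [_ Zi _ _] := FP _ FZ.
  exact: Zi (XZ _ Xz) (YZ _ Yz).
- move=> x y [u [X FX Xx]] [v [Y FY Yy]].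
  have [Z FZ [XZ YZ]] := chain_directed Ftot FX FY; have [_ _ Zt _] := FP _ FZ.
  have [||z Zz] := Zt x y; first by exists u; exact: XZ.
    by exists v; exact: YZ.
  by exists z, Z.
- move=> x y z [X FX Xz]; have [_ _ _ /(_ _ _ _ Xz)[]] := FP _ FX.
  by move=> [u Xu] [v Xv] [w Xw]; split; [exists u|exists v|exists w]; exists X.
Qed.

(** Hessenberg's theorem: an infinite cardinal equals its square. Take a
    maximal injection p : X * X -> X extending a pairing of the copy of [nat]
    in [T]. If X is at least as large as its complement, then [T] injects into
    two copies of X, hence into X, and p transports to [T]. Otherwise the
    complement contains a disjoint copy f(X) of X, and p extends to
    X `|` f(X): the pairs that are not in X * X form three copies of X * X,
    which p codes in X and f then moves into f(X). This contradicts the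
    maximality of p. *)
Lemma pairing_exists :
  exists p : T -> T -> T, forall x y x' y', p x y = p x' y' -> x = x' /\ y = y'.
Proof.
pose G0 : set (T * T * T) :=
  [set u | exists m n : nat, u = (nu m, nu n, nu (pickle (m, n)))].
have G0P : pairing_graph G0.
  split.
  - by move=> _ _ _ z' [m [n [-> -> ->]]] [m' [n' [/nu_inj-> /nu_inj->]]].
  - move=> _ q' _ [m [n [-> ->]]] [m' [n' [->]]].
    by move=> /nu_inj/(pcan_inj pickleK)[-> ->].
  - move=> _ _ [z [m [? [-> _ _]]]] [z' [n [? [-> _ _]]]].
    by exists (nu (pickle (m, n))), m, n.
  - have nu_field k : field G0 (nu k) by exists (nu (pickle (k, k))), k, k.
    by move=> _ _ _ [m [n [-> -> ->]]]; split; exact: nu_field.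
have [F FP _ Ftot|G [[Gf Gi Gt Gr] G0G Gmax]] := Zorn_above G0P.
  exact: pairing_graph_chain.
set X := field G in Gt Gr.
have Xnu k : X (nu k).
  by exists (nu (pickle (k, k))); apply: G0G; exists k, k.
have [q|p' pP'] := @choice (T * T) T (fun q z => X q.1 -> X q.2 -> G (q, z)).
  have [[X1 X2]|nX] := pselect (X q.1 /\ X q.2).
    by have [z Gz] := Gt _ _ X1 X2; exists z; rewrite -surjective_pairing in Gz.
  by exists (nu 0) => X1 X2; exfalso; exact: nX.
pose p x y := p' (x, y).
have pG x y : X x -> X y -> G (x, y, p x y) by exact: (pP' (x, y)).
have pX x y : X x -> X y -> X (p x y).
  by move=> Xx Xy; have [] := Gr _ _ _ (pG _ _ Xx Xy).
have pI x y x' y' : X x -> X y -> X x' -> X y' -> p x y = p x' y' ->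
    x = x' /\ y = y'.
  move=> Xx Xy Xx' Xy' e; have := pG _ _ Xx' Xy'; rewrite -e => h.
  by have [] := Gi _ _ _ (pG _ _ Xx Xy) h.
have [[f [fX fI]]|[f [fX fI]]] := card_comparable (~` X) X.
  (* The tags [nu 0] and [nu 1] keep the images of X and of its complement
     apart, so [e] injects the whole of [T] into X. *)
  pose e x := if pselect (X x) then p (nu 0) x else p (nu 1) (f x).
  have eX x : X (e x).
    by rewrite /e; case: pselect => [Xx|nXx]; apply: (pX) => //; exact: fX.
  have eI : injective e.
    move=> x y; rewrite /e; case: pselect => [Xx|nXx]; case: pselect => [Xy|nXy].
    - by case/pI.
    - by case/pI => //; [exact: fX|move/nu_inj].
    - by case/pI => //; [exact: fX|move/nu_inj].
    - by case/pI => //; [exact: fX|exact: fX|move=> _; apply: fI; exact: mem_set].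
  exists (fun x y => p (e x) (e y)) => x y x' y' /pI[]//.
  by move=> /eI -> /eI ->.
(* [u a] parametrizes X when [a] is true and its disjoint copy f(X) when [a]
   is false; [v a b x y] is the code of the pair (u a x, u b y), in f(X). *)
pose u (a : bool) x := if a then x else f x.
have uI a x b y : X x -> X y -> u a x = u b y -> a = b /\ x = y.
  case: a; case: b => //= Xx Xy e.
  - by have := fX _ Xy; rewrite -e.
  - by have := fX _ Xx; rewrite e.
  - by split=> //; apply: fI e; exact: mem_set.
pose v (a b : bool) x y := f (p (p (nu a) (nu b)) (p x y)).
pose G' := G `|` [set w | exists a b x y,
  [/\ X x, X y, ~~ (a && b) & w = (u a x, u b y, v a b x y)]].
have uG' a x : X x -> field G' (u a x).
  move=> Xx; case: a => /=; first by exists (p x x); left; exact: pG.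
  by exists (v false false x x); right; exists false, false, x, x.
have G'u x : field G' x -> exists a x', X x' /\ x = u a x'.
  move=> [z [/Gr[Xx _ _]|[a [b [x' [y' [Xx' _ _ [-> _ _]]]]]]]].
    by exists true, x.
  by exists a, x'.
have newN a b x y : X x -> X y -> X (u a x) -> X (u b y) -> a && b.
  by case: a; case: b => //= Xx Xy; [move=> _ /(fX _ Xy)//| |];
    move/(fX _ Xx).
have pXX a b x y : X x -> X y -> X (p (p (nu a) (nu b)) (p x y)).
  by move=> Xx Xy; apply: (pX); exact: (pX).
have vN a b x y : X x -> X y -> ~ X (v a b x y).
  by move=> Xx Xy; apply: (fX); exact: pXX.
have vI a b x y a' b' x' y' : X x -> X y -> X x' -> X y' ->
    v a b x y = v a' b' x' y' -> [/\ a = a', b = b', x = x' & y = y'].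
  move=> Xx Xy Xx' Xy' /fI e.
  have [|||| /pI[]// nua nub /pI[]// -> ->] := pI _ _ _ _ _ _ _ _
    (e (mem_set (pXX _ _ _ _ Xx Xy)) (mem_set (pXX _ _ _ _ Xx' Xy'))).
  - exact: (pX).
  - exact: (pX).
  - exact: (pX).
  - exact: (pX).
  split=> //; [move: (nu_inj nua)|move: (nu_inj nub)].
    by case: (a); case: (a').
  by case: (b); case: (b').
have G'P : pairing_graph G'.
  split.
  - move=> x y z z' [Gz|[a [b [x' [y' [Xx Xy ab [-> -> ->]]]]]]].
      case=> [|[a [b [x' [y' [Xx Xy ab [ex ey _]]]]]]]; first exact: Gf.
      case/negP: ab; have [Ux Uy _] := Gr _ _ _ Gz.
      by rewrite ex in Ux; rewrite ey in Uy; exact: newN Xx Xy Ux Uy.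
    case=> [/Gr[Ux Uy _]|[a1 [b1 [x1 [y1 [Xx1 Xy1 _ [ex ey ->]]]]]]].
      by case/negP: ab; exact: newN Xx Xy Ux Uy.
    have [-> ->] := uI _ _ _ _ Xx Xx1 ex.
    by have [-> ->] := uI _ _ _ _ Xy Xy1 ey.
  - move=> q q' z [Gz|[a [b [x' [y' [Xx Xy ab [-> ->]]]]]]].
      case=> [|[a [b [x' [y' [Xx Xy _ [_ ez]]]]]]]; first exact: Gi.
      case: q Gz => x y /Gr[_ _]; rewrite ez => /(vN _ _ _ _ Xx Xy)[].
    case=> [|[a1 [b1 [x1 [y1 [Xx1 Xy1 _ [-> ez]]]]]]].
      by case: q' => x y /Gr[_ _ /(vN _ _ _ _ Xx Xy)].
    by have [-> -> -> ->] := vI _ _ _ _ _ _ _ _ Xx Xy Xx1 Xy1 ez.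
  - move=> x0 y0 /G'u[a [x [Xx ->]]] /G'u[b [y [Xy ->]]].
    have [/andP[-> ->]|ab] := boolP (a && b).
      by exists (p x y); left; exact: pG.
    by exists (v a b x y); right; exists a, b, x, y.
  - move=> x y z [/Gr[Ux Uy Uz]|[a [b [x' [y' [Xx Xy _ [-> -> ->]]]]]]].
      by split; [exact: (uG' true x)|exact: (uG' true y)|exact: (uG' true z)].
    split; [exact: uG'|exact: uG'|].
    by apply: (uG' false); apply: (pX); exact: (pX).
(* Maximality would put the new point f (nu 0) in X. *)
have [|z G'z] := uG' false (nu 0); first exact: Xnu.
exfalso; apply: (fX (nu 0)); first exact: Xnu.
by exists z; apply: (Gmax _ G'P); [move=> ?; left|].
Qed.

End Pairing.

(** * Small sets closed under finitary choices *)

(** Binary trees in first-child, next-sibling form: a code evaluates to a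
    finite list, [Cons i j a r] being the list with tail [r] whose head is
    component [j] of the answer to request [i] on the parameters listed by
    [a]. This avoids an inductive type with lists of subtrees. *)
Inductive code (I : Type) : Type :=
  | Nil
  | Cons of I & nat & code I & code I.
Arguments Nil {I}.

Section SmallClosedSet.
Variables (T I : Type) (nu : nat -> T) (p : T -> T -> T) (iota : I -> T).
Hypothesis nu_inj : injective nu.
Hypothesis p_inj : forall x y x' y', p x y = p x' y' -> x = x' /\ y = y'.
Hypothesis iota_inj : injective iota.

Let pack (s : seq T) : T :=
  foldr (fun x t => p (nu 1) (p x t)) (p (nu 0) (nu 0)) s.

Let pack_inj : injective pack.
Proof.
elim=> [|x s IHs] [|x' s'] //= /p_inj[/nu_inj//].
by move=> _ /p_inj[-> /IHs ->].
Qed.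

Lemma seq_injects : exists e : seq T -> T, injective e.
Proof. by exists pack. Qed.

Let encode := fix encode (c : code I) : T :=
  if c is Cons i j a r then pack [:: iota i; nu j; encode a; encode r]
  else pack [::].

Let encode_inj : injective encode.
Proof.
elim=> [|i j a IHa r IHr] [|i' j' a' r'] // /pack_inj //.
by move=> [/iota_inj-> /nu_inj-> /IHa-> /IHr->].
Qed.

(** A downward Loewenheim-Skolem theorem. [Q i s x] reads: the sequence [x]
    answers request [i] on the finite list of parameters [s]. Fix an answer to
    every request that has one; the components of the answers generated from
    nothing, by requests whose parameters were already generated, form a set
    [H] in which every request with parameters in [H] has an answer as soon
    as it has one in [B]. Its elements are named by codes, hence [H] is no
    larger than [T]. An answer is an infinite sequence only so that all
    requests have answers of the same type. *)
Lemma small_closed_set (B : eqType) (b0 : B)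
    (Q : I -> seq B -> (nat -> B) -> Prop) :
  exists H : set B,
    (exists e : B -> T, set_inj H e) /\
    forall i s, {in s, forall x, H x} -> (exists x, Q i s x) ->
      exists2 x, forall j, H (x j) & Q i s x.
Proof.
have [[i s]|phi phiP] := @choice (I * seq B) (nat -> B)
    (fun q x => (exists y, Q q.1 q.2 y) -> Q q.1 q.2 x).
  have [[x Qx]|nQ] := pselect (exists x, Q i s x); first by exists x.
  by exists (fun=> b0) => /nQ.
pose fix eval (c : code I) : seq B :=
  if c is Cons i j a r then phi (i, eval a) j :: eval r else [::].
pose H : set B := [set x | exists c r, eval c = x :: r].
have [x|d dP] :=
    @choice B (code I) (fun x c => H x -> exists r, eval c = x :: r).
  by have [[c cx]|nH] := pselect (H x); [exists c|exists Nil].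
exists H; split.
  exists (encode \o d) => // x y /set_mem Hx /set_mem Hy /encode_inj e.
  by have [r] := dP _ Hx; have [r'] := dP _ Hy; rewrite e => -> [].
move=> i s Hs Qs.
have [c cs] : exists c, eval c = s.
  elim: s Hs {Qs} => [|x s IHs] Hs; first by exists Nil.
  have [y sy|r rs] := IHs; first by apply: Hs; rewrite inE sy orbT.
  have [[|k j a r'] [s' //= [ex _]]] := Hs x (mem_head _ _).
  by exists (Cons k j a r); rewrite /= ex rs.
exists (phi (i, s)); last exact: (phiP (i, s)).
by move=> j; exists (Cons i j c Nil), [::]; rewrite /= cs.
Qed.

End SmallClosedSet.

(** What a small subset of a module must be closed under to become a good
    submodule: it contains a given point, is closed under r x + y, and
    contains solutions of linear systems, of two kinds told apart by the
    boolean. The meaning of the requests is given in [small_submodule]. *)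
Inductive request (R : Type) : Type :=
  | Point
  | Combine of R
  | Solve of bool & {m & {n & 'M[R]_(m, n)}}.
Arguments Point {R}.

(** The sizes [m] and [n] are part of the code because the list of the entries
    does not determine the shape of the matrix. *)
Lemma request_injects (R : Type) :
  exists e : request R -> seq (R + nat), injective e.
Proof.
pose entries m n (L : 'M[R]_(m, n)) := codom (fun ij => L ij.1 ij.2).
have entries_inj m n : injective (@entries m n).
  move=> L L' /eq_in_map e; apply/matrixP => i j.
  by apply: (e (i, j)); rewrite mem_enum.
exists (fun q => match q with
  | Point => [::]
  | Combine r => [:: inl r]
  | Solve b (existT m (existT n L)) =>
      [:: inr (nat_of_bool b), inr m, inr n & map inl (entries m n L)]
  end).
case=> [|r|b [m [n L]]] [|r'|b' [m' [n' L']]] //=; first by case=> ->.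
case=> bb' mm' nn'; subst m' n' => /(inj_map _)/entries_inj -> //; last first.
  by move=> x y [].
by congr (Solve _ _); move: bb'; case: (b); case: (b').
Qed.

Local Open Scope ring_scope.

(** * Submodules, graphs of linear maps and linear systems *)

Section Submodules.
Variable R : pzRingType.
Implicit Types B E : lmodType R.

Definition submodule_set B (A : set B) :=
  A 0 /\ forall r x y, A x -> A y -> A (r *: x + y).

Section Closure.
Variables (B : lmodType R) (A : set B).
Hypothesis sA : submodule_set A.

Lemma submoduleD x y : A x -> A y -> A (x + y).
Proof. by move=> Ax Ay; rewrite -[x]scale1r; exact: sA.2. Qed.

Lemma submoduleZ r x : A x -> A (r *: x).
Proof. by move=> Ax; rewrite -[_ *: _]addr0; apply: sA.2 => //; exact: sA.1. Qed.

Lemma submoduleN x : A x -> A (- x).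
Proof. by move=> Ax; rewrite -scaleN1r; exact: submoduleZ. Qed.

Lemma submoduleB x y : A x -> A y -> A (x - y).
Proof. by move=> Ax Ay; apply: submoduleD => //; exact: submoduleN. Qed.
End Closure.

(** Indexed by the proof [sA], so that the module structure of
    [submodule_type] can be inferred from the type alone. *)
Definition submodule_mem B (A : set B) (sA : submodule_set A) : pred B :=
  fun x => `[< A x >].

Lemma submodule_mem_closed B (A : set B) (sA : submodule_set A) :
  subsemimod_closed (submodule_mem sA).
Proof.
split; first split.
- by apply/asboolP; exact: sA.1.
- by move=> x y /asboolP Ax /asboolP Ay; apply/asboolP; exact: submoduleD.
- by move=> r x /asboolP Ax; apply/asboolP; exact: submoduleZ.
Qed.

Record submodule_type B (A : set B) (sA : submodule_set A) := Submodule {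
  submodule_val : B;
  submodule_valP : submodule_mem sA submodule_val }.

Section SubmoduleType.
Variables (B : lmodType R) (A : set B) (sA : submodule_set A).

HB.instance Definition _ := [isSub for @submodule_val B A sA].
HB.instance Definition _ := [Choice of submodule_type sA by <:].
HB.instance Definition _ :=
  GRing.SubChoice_isSubLmodule.Build R B (submodule_mem sA) (submodule_type sA)
    (submodule_mem_closed sA).

Lemma submodule_valA (u : submodule_type sA) : A (val u).
Proof. exact/asboolP/(valP u). Qed.

Definition submodule_elt x (Ax : A x) : submodule_type sA :=
  Submodule (introT (asboolP _) Ax).
End SubmoduleType.

(** Graphs of linear maps to [E] defined on a submodule of [B]; by linearity,
    single-valuedness need only be required at 0. *)
Definition functional_graph B E (G : set (B * E)) :=
  submodule_set G /\ forall y, G (0, y) -> y = 0.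

Lemma functional_graph_inj B E (G : set (B * E)) x y y' :
  functional_graph G -> G (x, y) -> G (x, y') -> y = y'.
Proof.
move=> [sG G0] Gy Gy'; apply/eqP; rewrite -subr_eq0; apply/eqP/G0.
by rewrite -(subrr x); exact: (submoduleB sG Gy Gy').
Qed.

(** Linear maps are obtained below from their graphs: inclusions between
    submodules, restrictions of partial maps, and the final extension. *)
Lemma graph_linear B E (G : set (B * E)) :
    functional_graph G -> (forall x, exists y, G (x, y)) ->
  exists h : {linear B -> E}, forall x, G (x, h x).
Proof.
move=> fG /choice[h hG].
have h_linear : linear h.
  move=> r x y; apply: (functional_graph_inj fG) (hG _) _.
  exact: (fG.1.2 r _ _ (hG x) (hG y)).
pose hM := GRing.isLinear.Build R B E *:%R h h_linear.
pose hL : {linear B -> E} := HB.pack h hM.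
by exists hL.
Qed.

(** The left-hand sides of the linear system with matrix [L]. *)
Definition lin m n (L : 'M[R]_(m, n)) B (x : 'I_n -> B) (i : 'I_m) : B :=
  \sum_(j < n) L i j *: x j.

Lemma lin_map m n (L : 'M[R]_(m, n)) B E (f : {linear B -> E}) x i :
  f (lin L x i) = lin L (f \o x) i.
Proof. by rewrite /lin linear_sum; apply: eq_bigr => j _; rewrite linearZ. Qed.

Lemma linD m n (L : 'M[R]_(m, n)) B (x y : 'I_n -> B) i :
  lin L (fun j => x j + y j) i = lin L x i + lin L y i.
Proof. by rewrite /lin -big_split; apply: eq_bigr => j _; rewrite scalerDr. Qed.

Lemma linB m n (L : 'M[R]_(m, n)) B (x y : 'I_n -> B) i :
  lin L (fun j => x j - y j) i = lin L x i - lin L y i.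
Proof. by rewrite /lin -sumrB; apply: eq_bigr => j _; rewrite scalerBr. Qed.

Lemma lin_submodule m n (L : 'M[R]_(m, n)) B (A : set B) (x : 'I_n -> B) i :
  submodule_set A -> (forall j, A (x j)) -> A (lin L x i).
Proof.
move=> sA Ax; apply: (big_ind A) => [|u v|j _]; first exact: sA.1.
  exact: submoduleD.
exact: submoduleZ.
Qed.

End Submodules.

(** * Purity relative to a set of linear systems *)

Section Purity.
Variable R : pzRingType.
Variable Sigma : forall m n, 'M[R]_(m, n) -> Prop.
Implicit Types B E : lmodType R.

(** With no system in [Sigma] this is no condition on [A]; the one-by-one
    systems [r x = a] give the RD condition, and all systems give purity. *)
Definition pure_in B (A : set B) :=
  forall m n (L : 'M[R]_(m, n)), Sigma L -> forall a : 'I_m -> B,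
    (forall i, A (a i)) -> (exists x, lin L x =1 a) ->
  exists2 x : 'I_n -> B, forall j, A (x j) & lin L x =1 a.

Definition pure_embedding : hom_class R := fun A B f =>
  injective f /\
  forall m n (L : 'M[R]_(m, n)), Sigma L -> forall a : 'I_m -> A,
    (exists b, lin L b =1 f \o a) -> exists x, lin L x =1 a.

Lemma pure_embedding_range (A B : lmodType R) (f : {linear A -> B}) :
  pure_embedding f -> pure_in (range f).
Proof.
move=> [fI fP] m n L SL a ra [b Lb].
have [i|a' fa'] := @choice 'I_m A (fun i u => f u = a i).
  by have [u _ <-] := ra i; exists u.
have [|x Lx] := fP _ _ _ SL a'; first by exists b => i; rewrite Lb /= fa'.
exists (f \o x) => [j|i]; first by exists (x j).
by rewrite -lin_map Lx fa'.
Qed.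

Lemma pure_in_embedding B (A C : set B) (sA : submodule_set A)
    (sC : submodule_set C)
    (f : {linear submodule_type sA -> submodule_type sC}) :
    pure_in A -> (forall u, val (f u) = val u) -> pure_embedding f.
Proof.
move=> pA fval; split=> [u v /(congr1 val)|m n L SL a [b Lb]].
  by rewrite !fval => /val_inj.
have [i||x Ax Lx] := pA _ _ _ SL (fun i => val (a i)).
- exact: submodule_valA.
- exists (fun j => val (b j)) => i.
  by rewrite -fval -[f _]Lb lin_map.
exists (fun j => submodule_elt sA (Ax j)) => i.
by apply: val_inj; rewrite lin_map -Lx.
Qed.

Lemma pure_in_val B (A : set B) (sA : submodule_set A) :
  pure_in A -> pure_embedding (val : {linear submodule_type sA -> B}).
Proof.
move=> pA; split=> [|m n L SL a [b Lb]]; first exact: val_inj.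
have [i||x Ax Lx] := pA _ _ _ SL (fun i => val (a i)).
- exact: submodule_valA.
- by exists b.
exists (fun j => submodule_elt sA (Ax j)) => i.
by apply: val_inj; rewrite lin_map -Lx.
Qed.

(** Every point [b] lies in a small pure submodule [H] that is in good position
    with respect to a given pure submodule [A].

    [H] is closed under solving two kinds of systems with constants c in [H]:
    [L x = c] with x in [A], and [L x = c] modulo [A]. Purity of the three
    submodules follows.
    - [A `&` H]: if the constants lie in [A `&` H], then [A] contains a
      solution by purity, and the first closure moves it to [A `&` H].
    - [H]: if [L x = c] with c in [H], the second closure gives x0 in [H] that
      solves the system modulo [A]. The defect c - L x0 lies in [A `&` H], is
      attained by x - x0, hence by some y in [A `&` H]; then y + x0 works.
    - [A + H]: for constants a + c, solve modulo [A] by x0 in [H]; the defect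
      a + (c - L x0) lies in [A] and is attained by purity of [A]. *)
Lemma small_submodule B (A : set B) (b : B) :
    submodule_set A -> pure_in A ->
  exists H : set B,
    [/\ submodule_set H, H b, exists e : B -> R + nat, set_inj H e
      & [/\ pure_in H, pure_in (A `&` H)
      & pure_in [set x | exists2 a, A a & exists2 y, H y & x = a + y]]].
Proof.
move=> sA pA.
have nu_inj : injective (@inr R nat) by move=> ? ? [].
have [p p_inj] := pairing_exists nu_inj.
have [e1 e1_inj] := request_injects R.
have [e2 e2_inj] := seq_injects nu_inj p_inj.
pose Q (q : request R) (s : seq B) (x : nat -> B) : Prop := match q with
  | Point => x 0%N = b
  | Combine r => x 0%N = r *: s`_0 + s`_1
  | Solve inA (existT m (existT n L)) =>
      let y (j : 'I_n) := x j in
      if inA then (forall j, A (y j)) /\ forall i, lin L y i = s`_i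
      else forall i, A (lin L y i - s`_i)
  end.
have [H [eH closedH]] :=
  small_closed_set nu_inj p_inj (inj_comp e2_inj e1_inj) b Q.
have Hb : H b.
  by have [] := closedH Point [::]; [|exists (fun=> b)|move=> x Hx <-].
have HC r x y : H x -> H y -> H (r *: x + y).
  move=> Hx Hy; have [||z Hz <- //] := closedH (Combine r) [:: x; y].
    by move=> z; rewrite !inE => /orP[]/eqP->.
  by exists (fun=> r *: x + y).
have sH : submodule_set H.
  by split=> //; rewrite -(subrr b) addrC -scaleN1r; exact: HC.
(* Answers are sequences, solutions are finite tuples: pad with 0. *)
have extend n (x : 'I_n -> B) : exists y : nat -> B, forall j : 'I_n, y j = x j.
  exists (fun k => if insub k is Some j then x j else 0) => j.
  by rewrite valK.
have solve_mod m n (L : 'M[R]_(m, n)) (c : 'I_m -> B) : (forall i, H (c i)) ->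
    (exists x, forall i, A (lin L x i - c i)) ->
    exists2 x : 'I_n -> B, forall j, H (x j) & forall i, A (lin L x i - c i).
  move=> Hc [x Lx]; have [y yx] := extend _ x.
  have [||z Hz /= Lz] :=
    closedH (Solve false (existT _ m (existT _ n L))) (mktuple c).
  - by move=> _ /mapP[i _ ->].
  - exists y => /= i; rewrite nth_mktuple (_ : lin _ _ _ = lin L x i) //.
    by apply: eq_bigr => j _; rewrite yx.
  by exists (fun j => z j) => // i; have := Lz i; rewrite nth_mktuple.
have solve_in m n (L : 'M[R]_(m, n)) (c : 'I_m -> B) : (forall i, H (c i)) ->
    (exists2 x, forall j, A (x j) & forall i, lin L x i = c i) ->
    exists2 x : 'I_n -> B, forall j, (A `&` H) (x j)
      & forall i, lin L x i = c i.
  move=> Hc [x Ax Lx]; have [y yx] := extend _ x.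
  have [||z Hz /= [Az Lz]] :=
    closedH (Solve true (existT _ m (existT _ n L))) (mktuple c).
  - by move=> _ /mapP[i _ ->].
  - exists y; split=> /= [j|i]; first by rewrite yx.
    by rewrite nth_mktuple -Lx; apply: eq_bigr => j _; rewrite yx.
  exists (fun j => z j) => [j|i]; first by split; [exact: Az|exact: Hz].
  by have := Lz i; rewrite nth_mktuple.
have pAH : pure_in (A `&` H).
  move=> m n L SL a AHa La; have [i|x Ax Lx] := pA _ _ _ SL a _ La.
    by have [] := AHa i.
  by apply: solve_in; [move=> i; have [] := AHa i|exists x].
exists H; split=> //; split=> //.
  move=> m n L SL a Ha [x Lx].
  have [|x0 Hx0 Ax0] := solve_mod _ _ L a Ha.
    by exists x => i; rewrite Lx subrr; exact: sA.1.
  have [i||y AHy Ly] := pAH _ _ _ SL (fun i => a i - lin L x0 i).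
  - split; first by rewrite -opprB; exact: submoduleN.
    by apply: submoduleB => //; exact: lin_submodule.
  - by exists (fun j => x j - x0 j) => i; rewrite linB Lx.
  exists (fun j => y j + x0 j) => [j|i].
    by apply: submoduleD => //; have [] := AHy j.
  by rewrite linD Ly subrK.
move=> m n L SL a AHa [x Lx].
have [i|c cP] := @choice 'I_m (B * B)
  (fun i q => [/\ A q.1, H q.2 & a i = q.1 + q.2]).
  by have [u Au [v Hv e]] := AHa i; exists (u, v).
have [i||x0 Hx0 Ax0] := solve_mod _ _ L (fun i => (c i).2).
- by have [] := cP i.
- by exists x => i; rewrite Lx; have [Ac _ ->] := cP i; rewrite addrK.
have [i||y Ay Ly] := pA _ _ _ SL (fun i => a i - lin L x0 i).
- have [Ac _ ->] := cP i; rewrite -addrA; apply: submoduleD => //.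
  by rewrite -opprB; exact: submoduleN.
- by exists (fun j => x j - x0 j) => i; rewrite linB Lx.
exists (fun j => y j + x0 j) => [j|i].
  by exists (y j) => //; exists (x0 j).
by rewrite linD Ly subrK.
Qed.

End Purity.

(** The bound passes to subsets of a small set [H] because both [H] and its
    intersection with a submodule have to be small. *)
Lemma card_le_ring_submodule (R : pzRingType) (B : lmodType R) (A H : set B)
    (sA : submodule_set A) (e : B -> R + nat) :
  A `<=` H -> set_inj H e -> card_le_ring (submodule_type sA).
Proof.
move=> AH eH.
have [f] : $|{injfun [set: submodule_type sA] >-> [set: (R + nat)%type]}|.
  apply/injfunPex; exists (e \o val) => // u v _ _ euv; apply: val_inj.
  by apply: eH euv; apply/mem_set/AH; exact: submodule_valA.
exact: inj_card_le f.
Qed.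

(** * Extending maps along pure embeddings *)

Section Baer.
Variables (R : pzRingType) (Sigma : forall m n, 'M[R]_(m, n) -> Prop).
Variables (K : lmodType R -> Prop) (E : lmodType R).
Hypothesis hsub : closed_submodules (pure_embedding Sigma) K.
Hypothesis htest :
  forall (A B : lmodType R) (f : {linear A -> B}) (g : {linear A -> E}),
  K A -> K B -> card_le_ring A -> card_le_ring B -> pure_embedding Sigma f ->
  exists h : {linear B -> E}, h \o f =1 g.

Definition domain (B : lmodType R) (G : set (B * E)) : set B :=
  [set x | exists y, G (x, y)].

Lemma domain_submodule (B : lmodType R) (G : set (B * E)) :
  submodule_set G -> submodule_set (domain G).
Proof.
move=> sG; split; first by exists 0; exact: sG.1.
by move=> r x y [u Gu] [v Gv]; exists (r *: u + v); exact: (sG.2 r _ _ Gu Gv).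
Qed.

(** The partial maps from [B] to [E] to which Zorn's lemma is applied. *)
Definition pure_graph (B : lmodType R) (G : set (B * E)) :=
  functional_graph G /\ pure_in Sigma (domain G).

Lemma pure_graph_chain (B : lmodType R) (F : set (set (B * E))) :
    F `<=` @pure_graph B -> F !=set0 -> total_on F subset ->
  pure_graph (\bigcup_(G in F) G).
Proof.
move=> FP F0 Ftot; split; first split; first split.
- by have [G FG] := F0; exists G => //; exact: (FP _ FG).1.1.1.
- move=> r u v [X FX Xu] [Y FY Yv].
  have [Z FZ [XZ YZ]] := chain_directed Ftot FX FY.
  by exists Z => //; apply: (FP _ FZ).1.1.2; [exact: XZ|exact: YZ].
- by move=> y [G FG Gy]; exact: (FP _ FG).1.2.
move=> m n L SL a /choice[c cP] La.
have [G FG Gc] := chain_finite F0 Ftot cP.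
have [i|x Gx Lx] := (FP _ FG).2 _ _ _ SL a _ La.
  by exists (c i); exact: Gc.
by exists x => // j; have [y Gy] := Gx j; exists y, G.
Qed.

(** The one-step extension. With A the domain of [G] and [H] as in
    [small_submodule], the inclusion of [A `&` H] in [H] is a small pure
    embedding between members of [K], so the restriction to [A `&` H] of the
    partial map extends to some h on [H]. The partial map and h agree on
    [A `&` H], hence glue to a map on A + H, which is pure. *)
Lemma pure_graph_extend (B : lmodType R) (G : set (B * E)) (b : B) :
    K B -> pure_graph G ->
  exists2 G', pure_graph G' & G `<=` G' /\ domain G' b.
Proof.
move=> KB [[sG G0] pG]; pose A := domain G.
have sA : submodule_set A := domain_submodule sG.
have [H [sH Hb [e eH] [pH pAH pAHs]]] := small_submodule b sA pG.
have sAH : submodule_set (A `&` H).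
  split; first by split; [exact: sA.1|exact: sH.1].
  by move=> r x y [Ax Hx] [Ay Hy]; split; [exact: sA.2|exact: sH.2].
have K_sub (C : set B) (sC : submodule_set C) :
    pure_in Sigma C -> K (submodule_type sC).
  by move=> pC; exact: hsub KB (pure_in_val sC pC).
have [|u|inc incE] := @graph_linear R (submodule_type sAH) (submodule_type sH)
    [set q | val q.1 = val q.2].
- split; first split=> //=.
    by move=> r x y -> ->.
  by move=> y e0; exact/val_inj/esym.
- have [_ Hu] := submodule_valA u.
  by exists (submodule_elt sH Hu).
have [|u|g gE] := @graph_linear R (submodule_type sAH) E
    [set q | G (val q.1, q.2)].
- split; first split; first exact: sG.1.
    by move=> r x y Gx Gy; exact: (sG.2 r _ _ Gx Gy).
  exact: G0.
- by have [[y Gy] _] := submodule_valA u; exists y.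
have [|||||h hE] := htest (f := inc) g.
- exact: K_sub.
- exact: K_sub.
- by apply: card_le_ring_submodule eH => x [].
- exact: card_le_ring_submodule eH.
- by apply: pure_in_embedding => // u; rewrite -incE.
exists [set q | exists x z (w : submodule_type sH),
  G (x, z) /\ q = (x + val w, z + h w)].
  split; first split; first split.
  - by exists 0, 0, 0; rewrite !linear0 !addr0; split; first exact: sG.1.
  - move=> r _ _ [x [z [w [Gxz ->]]]] [x' [z' [w' [Gxz' ->]]]].
    exists (r *: x + x'), (r *: z + z'), (r *: w + w'); split.
      exact: (sG.2 r _ _ Gxz Gxz').
    by rewrite !linearP; congr (_, _) => /=; rewrite scalerDr addrACA.
  - (* If x + w = 0 then w = - x lies in [A `&` H], where h agrees with the
       partial map; so h w = - z. *)
    move=> y [x [z [w [Gxz [xw ->]]]]].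
    have wx : val w = - x by apply/eqP; rewrite -addr_eq0 addrC -xw.
    have Gw : G (val w, - z) by rewrite wx; exact: (submoduleN sG Gxz).
    have AHw : (A `&` H) (val w) by split; [exists (- z)|exact: submodule_valA].
    have gw : g (submodule_elt sAH AHw) = - z.
      have Gg := gE (submodule_elt sAH AHw).
      exact: functional_graph_inj (conj sG G0) Gg Gw.
    have -> : w = inc (submodule_elt sAH AHw) by apply: val_inj; rewrite -incE.
    by rewrite [h _]hE gw subrr.
  rewrite (_ : domain _ =
    [set x | exists2 a, A a & exists2 y, H y & x = a + y]) //.
  apply/seteqP; split=> [_ [_ [x [z [w [Gxz [-> _]]]]]]|_ [x [z Gz] [y Hy ->]]].
    by exists x; [exists z|exists (val w); [exact: submodule_valA|]].
  by exists (z + h (submodule_elt sH Hy)), x, z, (submodule_elt sH Hy).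
split=> [[x z] Gxz|].
  by exists x, z, 0; rewrite !linear0 !addr0.
exists (h (submodule_elt sH Hb)), 0, 0, (submodule_elt sH Hb).
by split; [exact: sG.1|rewrite !add0r].
Qed.

Lemma baer_criterion (A B : lmodType R) (f : {linear A -> B})
    (g : {linear A -> E}) :
    K B -> pure_embedding Sigma f -> exists h : {linear B -> E}, h \o f =1 g.
Proof.
move=> KB pf; pose G0 : set (B * E) := range (fun a => (f a, g a)).
have pG0 : pure_graph G0.
  split; first split; first split.
  - by exists 0; rewrite ?linear0.
  - move=> r _ _ [x _ <-] [y _ <-].
    by exists (r *: x + y); rewrite // !linearP.
  - by move=> y [x _ [fx <-]]; rewrite (_ : x = 0) ?linear0 //; apply: pf.1;
      rewrite fx linear0.
  rewrite (_ : domain G0 = range f); first exact: pure_embedding_range.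
  apply/seteqP; split=> [_ [_ [x _ [<- _]]]|_ [x _ <-]]; first by exists x.
  by exists (g x), x.
have [G [[fG pG] sub Gmax]] := Zorn_above pG0 (@pure_graph_chain B).
have [b|h hG] := graph_linear fG.
  have [G' pG' [GG' [y G'y]]] := pure_graph_extend b KB (conj fG pG).
  by exists y; exact: Gmax pG' GG' _ G'y.
exists h => x; apply: (functional_graph_inj fG (hG _)).
by apply: sub; exists x.
Qed.

End Baer.

(** The three classes differ only in the systems whose solvability they
    reflect; the condition f[A] `&` rB = r f[A] says that every equation
    r x = f(a) with a solution in B comes from a solution of r x = a in A. *)
Lemma embedding_class_pure (R : pzRingType) (M : hom_class R) :
    M = @all_embeddings R \/ M = @RD_embeddings R \/ M = @pure_embeddings R ->
  exists Sigma : forall m n, 'M[R]_(m, n) -> Prop,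
    forall (A B : lmodType R) (f : {linear A -> B}),
      M A B f <-> pure_embedding Sigma f.
Proof.
case=> [->|[->|->]].
- exists (fun _ _ _ => False) => A B f; split=> [f_inj|[]//].
  by split=> // m n L [].
- exists (fun m n _ => m = 1%N /\ n = 1%N) => A B f; split=> -[f_inj fP].
    split=> // m n L [m1 n1]; subst m n => a [b Lb].
    have [_ [x _ <-] fx] : [set L ord0 ord0 *: b | b in range f] (f (a ord0)).
      rewrite -fP; split; first by exists (a ord0).
      by exists (b ord0) => //; have := Lb ord0; rewrite /lin big_ord1.
    exists (fun=> x) => i; rewrite /lin big_ord1 ord1; apply: f_inj.
    by rewrite linearZ.
  split=> // r; apply/seteqP; split=> [_ [[a _ <-] [b _ rb]]|_ [_ [x _ <-] <-]].
    have [|x Lx] := fP 1%N 1%N (const_mx r) (conj erefl erefl) (fun=> a).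
      by exists (fun=> b) => i; rewrite /lin big_ord1 mxE.
    have := Lx ord0; rewrite /lin big_ord1 mxE => rx.
    by exists (f (x ord0)); [exists (x ord0)|rewrite -linearZ rx].
  split; first by exists (r *: x); rewrite ?linearZ.
  by exists (f x).
- exists (fun _ _ _ => True) => A B f; split=> -[f_inj fP]; split=> // m n L.
    by move=> _; exact: fP.
  exact: fP.
Qed.

Theorem theorem4p8 (R : pzRingType) (M : hom_class R)
    (hM : M = @all_embeddings R \/ M = @RD_embeddings R \/ M = @pure_embeddings R)
    (K : lmodType R -> Prop)
    (hsum : closed_direct_sums K)
    (hsub : closed_submodules M K)
    (hepi : closed_epimorphic_images M K)
    (E : lmodType R) (hE : K E) :
  relatively_injective K M E <->
  (forall (A B : lmodType R) (f : {linear A -> B}) (g : {linear A -> E}),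
     K A -> K B -> card_le_ring A -> card_le_ring B -> M A B f ->
     exists h : {linear B -> E}, h \o f =1 g).
Proof.
split=> [[_ E_inj] A B f g KA KB _ _|htest]; first exact: E_inj.
have [Sigma MP] := embedding_class_pure hM.
split=> // A B f g _ KB /MP; apply: baer_criterion KB.
- by move=> C S D KC /MP; exact: hsub.
- by move=> C D f' g' KC KD cC cD /MP; exact: htest.
Qed.
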